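(* Let $N$ be a positive number and let $\mu$ be a quasi-weight on $\mathrm{Cu}_2\setminus\{\lozenge\}$ such that $\mu\ge 1$ and $\mu(s)\ge N$ for each $s\in\mathrm{Cu}_2\setminus\{\lozenge\}$ with $s\notin I(\mathrm{Cu}_2)$. Then $$C_{\mathrm{PI}}\big(\ell^1(\mathrm{Cu}_2\setminus\{\lozenge\},\mu),\#\big)\ \ge\ (N/86)^{1/3}.$$
   Context: $\mathrm{Cu}_2$ is the monoid with identity $e$ and zero element $\lozenge$ (so $\lozenge s=\lozenge=s\lozenge$ for all $s$) generated by $a_1,a_2,b_1,b_2$ subject to the relations $a_1b_1=e=a_2b_2$ and $a_1b_2=\lozenge=a_2b_1$. $I(\mathrm{Cu}_2)$ denotes the set of idempotents $s=s^2$ of $\mathrm{Cu}_2$ other than $\lozenge$. A weight on a monoid $S$ with identity $e$ is a function $\omega:S\to(0,+\infty)$ with $\omega(st)\le\omega(s)\omega(t)$ for all $s,t\in S$ and $\omega(e)=1$. If $S$ has a zero element $\lozenge$, a quasi-weight is the restriction $\mu=\omega|_{S\setminus\{\lozenge\}}$ of a weight $\omega$ on $S$. Then $\ell^1(S\setminus\{\lozenge\},\mu)$ is the Banach space of $f:S\setminus\{\lozenge\}\to\mathbb C$ with $\|f\|_\mu=\sum_s|f(s)|\mu(s)<\infty$. It becomes a unital Banach algebra (unit $\delta_e$, of norm $1$) with the bounded bilinear product $\#$ determined by $\delta_s\#\delta_t=\delta_{st}$ if $st\ne\lozenge$ and $\delta_s\#\delta_t=0$ if $st=\lozenge$. For a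 unital Banach algebra $\mathcal A$, $$C_{\mathrm{PI}}(\mathcal A)=\inf\{\|a\|\|b\|\|c\|\|d\| : a,b,c,d\in\mathcal A,\ ab=1=cd,\ ad=0=cb\},$$ with $\inf\emptyset=+\infty$. *)

(* Defs.v *)
From HB Require Import structures.
From mathcomp Require Import all_boot all_order all_algebra.
From mathcomp Require Import generic_quotient finmap complex.
From mathcomp Require Import all_classical all_reals all_analysis.
From mathcomp.analysis Require Import showcase.summability.

Set Implicit Arguments.
Unset Strict Implicit.
Unset Printing Implicit Defensive.

Import Order.TTheory GRing.Theory Num.Theory.
Import numFieldNormedType.Exports.

Local Open Scope classical_set_scope.
Local Open Scope ring_scope.

HB.mixin Record Monoid_hasZero S of Monoid S := {
  lozenge : S;
  mul_lozenge : forall s : S, (lozenge * s)%g = lozenge;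
  lozenge_mul : forall s : S, (s * lozenge)%g = lozenge
}.

#[short(type="monoid0Type")]
HB.structure Definition Monoid0 := {S of Monoid S & Monoid_hasZero S}.

Definition nonzero (S : monoid0Type) := {s : S | s != lozenge}.

Definition idempotents (S : monoid0Type) : set S :=
  [set s | s = (s * s)%g /\ s <> lozenge].

Definition weight (R : realType) (S : monoidType) (omega : S -> R) : Prop :=
  [/\ forall s, 0 < omega s,
      forall s t, omega (s * t)%g <= omega s * omega t
    & omega 1%g = 1].

Definition quasi_weight (R : realType) (S : monoid0Type)
    (mu : nonzero S -> R) : Prop :=
  exists2 omega : S -> R, weight omega & forall s, mu s = omega (val s).

(* ‖f‖_mu as an extended real: it is +oo exactly when f is not in ell^1. *)
Definition l1_enorm (R : realType) (S : monoid0Type) (mu : nonzero S -> R)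
    (f : nonzero S -> R[i]) : \bar R :=
  (\esum_(s in setT) (complex.Re `|f s| * mu s)%:E)%E.

Definition l1 (R : realType) (S : monoid0Type) (mu : nonzero S -> R) :
    set (nonzero S -> R[i]) :=
  [set f | (l1_enorm mu f < +oo)%E].

Definition l1_norm (R : realType) (S : monoid0Type) (mu : nonzero S -> R)
    (f : nonzero S -> R[i]) : R :=
  fine (l1_enorm mu f).

(* For s = lozenge this is the zero function. *)
Definition delta (R : realType) (S : monoid0Type) (s : S) :
    nonzero S -> R[i] :=
  fun t => (val t == s)%:R.

(* The product #, (f # g)(r) = \sum_(st = r) f(s) g(t). The fibre of r may be
   infinite, so this is an unconditional sum, i.e. the limit of the sums over
   the finite sets of pairs; it converges absolutely for f, g in ell^1
   when mu is a quasi-weight. *)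
Definition l1_mul (R : realType) (S : monoid0Type)
    (f g : nonzero S -> R[i]) : nonzero S -> R[i] :=
  fun r => summability.sum (fun p : nonzero S * nonzero S =>
    (if (val p.1 * val p.2)%g == val r then f p.1 * g p.2 else 0) : R[i]^o).

Lemma l1_mul_delta (R : realType) (S : monoid0Type) (s t : S) :
  l1_mul (@delta R S s) (@delta R S t) = @delta R S (s * t)%g.
Proof.
have PF := @totally_filter (nonzero S * nonzero S)%type.
have hF := @norm_hausdorff _ R[i]^o.
apply/funext => r; rewrite /l1_mul /summability.sum.
set F := (X in partial_sum X).
have F0 p : (val p.1, val p.2) != (s, t) -> F p = 0.
  rewrite /F /delta xpair_eqE negb_and => /orP[]/negbTE ->;
  by rewrite ?mul0r ?mulr0; case: ifP.
have FE p : (val p.1, val p.2) = (s, t) -> F p = delta R (s * t)%g r.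
  by move=> [ps pt]; rewrite /F /delta/= ps pt !eqxx mulr1 eq_sym; case: eqP.
have [[p pst]|nst] := pselect (exists p : nonzero S * nonzero S,
    (val p.1, val p.2) = (s, t)); last first.
  have -> : delta R (s * t)%g r = 0.
    rewrite /delta; case: eqP => // rst; exfalso; apply: nst.
    have s0 : s != lozenge.
      by apply: contraNneq (valP r) => s0; rewrite rst s0 mul_lozenge.
    have t0 : t != lozenge.
      by apply: contraNneq (valP r) => t0; rewrite rst t0 lozenge_mul.
    by exists (exist _ s s0, exist _ t t0).
  rewrite (_ : partial_sum F = cst 0); first (apply: (@cvg_lim _ hF _ _ PF); exact: cvg_cst).
  apply/funext => A; apply: big1 => i _; apply: F0.
  by apply/eqP => e; apply: nst; exists (val i).
apply: (@cvg_lim _ hF _ _ PF); rewrite -(FE p pst).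
apply: cvg_near_cst; exists [fset p]%fset => //= A /fsubsetP/(_ p (fset11 p)) pA.
rewrite /partial_sum (bigD1 [` pA]%fset)//= big1 ?addr0// => i ip.
apply: F0; apply: contra ip => /eqP; rewrite -pst.
case: i => -[i1 i2] iA /= [] e1 e2.
by apply/eqP/val_inj; rewrite /=; case: (p) e1 e2 => p1 p2 /= /val_inj -> /val_inj ->.
Qed.

(* The constant C_PI of the algebra with underlying set A, product mul, zero
   zero, unit one and norm nrm; ereal_inf set0 = +oo. *)
Definition C_PI (R : realType) (T : Type) (A : set T) (mul : T -> T -> T)
    (zero one : T) (nrm : T -> R) : \bar R :=
  ereal_inf [set x : \bar R | exists a b c d : T,
    [/\ [/\ A a, A b, A c & A d],
        mul a b = one /\ mul c d = one,
        mul a d = zero /\ mul c b = zero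
      & x = (nrm a * nrm b * nrm c * nrm d)%:E]].

Definition C_PI_l1 (R : realType) (S : monoid0Type) (mu : nonzero S -> R) :
    \bar R :=
  C_PI (l1 mu) (@l1_mul R S) (fun=> 0) (@delta R S 1%g) (l1_norm mu).

(* Cu_2 is the quotient of the free monoid with zero on a_1, a_2, b_1, b_2 by
   the congruence generated by its relations. [inl i] is a_(i+1), [inr i] is
   b_(i+1), and [None] is the zero element of the free monoid with zero. *)
Definition Cu2_letter : Type := ('I_2 + 'I_2)%type.
Definition Cu2_word := option (seq Cu2_letter).

Definition Cu2_wmul (x y : Cu2_word) : Cu2_word :=
  if (x, y) is (Some u, Some v) then Some (u ++ v) else None.

Inductive Cu2_congr : Cu2_word -> Cu2_word -> Prop :=
| Cu2_congr_refl x : Cu2_congr x x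
| Cu2_congr_sym x y : Cu2_congr x y -> Cu2_congr y x
| Cu2_congr_trans x y z : Cu2_congr x y -> Cu2_congr y z -> Cu2_congr x z
| Cu2_congr_mul x x' y y' : Cu2_congr x x' -> Cu2_congr y y' ->
    Cu2_congr (Cu2_wmul x y) (Cu2_wmul x' y')
| Cu2_congr_rel (i j : 'I_2) :
    Cu2_congr (Some [:: inl i; inr j]) (if i == j then Some [::] else None).

Definition Cu2_rel : rel Cu2_word := fun x y => `[< Cu2_congr x y >].

Lemma Cu2_rel_refl : reflexive Cu2_rel.
Proof. by move=> x; apply/asboolP; exact: Cu2_congr_refl. Qed.

Lemma Cu2_rel_sym : symmetric Cu2_rel.
Proof. by move=> x y; apply: asbool_equiv_eq; split; exact: Cu2_congr_sym. Qed.

Lemma Cu2_rel_trans : transitive Cu2_rel.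
Proof.
move=> y x z /asboolP xy /asboolP yz; apply/asboolP.
exact: Cu2_congr_trans xy yz.
Qed.

Canonical Cu2_equiv := EquivRel Cu2_rel Cu2_rel_refl Cu2_rel_sym Cu2_rel_trans.

Definition Cu2 := {eq_quot Cu2_equiv}%qT.
HB.instance Definition _ := Choice.on Cu2.

Definition Cu2_pi (x : Cu2_word) : Cu2 := \pi_{eq_quot Cu2_equiv}%qT x.

Definition Cu2_mul (s t : Cu2) : Cu2 := Cu2_pi (Cu2_wmul (repr s) (repr t)).

Lemma Cu2_piP x y : Cu2_pi x = Cu2_pi y <-> Cu2_congr x y.
Proof.
split=> [/eqquotP/asboolP//|xy]; apply/eqquotP; exact/asboolP.
Qed.

Lemma Cu2_pi_mul x y : Cu2_mul (Cu2_pi x) (Cu2_pi y) = Cu2_pi (Cu2_wmul x y).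
Proof.
by apply/Cu2_piP/Cu2_congr_mul; apply/Cu2_piP; rewrite /Cu2_pi reprK.
Qed.

Lemma Cu2_ind (P : Cu2 -> Prop) : (forall x, P (Cu2_pi x)) -> forall s, P s.
Proof. by move=> Ppi s; rewrite -[s]reprK; exact: Ppi. Qed.

Lemma Cu2_mulA : associative Cu2_mul.
Proof.
elim/Cu2_ind=> x; elim/Cu2_ind=> y; elim/Cu2_ind=> z; rewrite !Cu2_pi_mul.
by case: x y z => [x|] [y|] [z|] //=; rewrite /Cu2_wmul catA.
Qed.

Lemma Cu2_mul1 : left_id (Cu2_pi (Some [::])) Cu2_mul.
Proof. by elim/Cu2_ind=> -[x|]; rewrite Cu2_pi_mul. Qed.

Lemma Cu2_mulr1 : right_id (Cu2_pi (Some [::])) Cu2_mul.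
Proof. by elim/Cu2_ind=> -[x|]; rewrite Cu2_pi_mul //= /Cu2_wmul cats0. Qed.

HB.instance Definition _ := isMonoid.Build Cu2 Cu2_mulA Cu2_mul1 Cu2_mulr1.

Lemma Cu2_mul0 s : Cu2_mul (Cu2_pi None) s = Cu2_pi None.
Proof. by elim/Cu2_ind: s => x; rewrite Cu2_pi_mul. Qed.

Lemma Cu2_mulr0 s : Cu2_mul s (Cu2_pi None) = Cu2_pi None.
Proof. by elim/Cu2_ind: s => -[x|]; rewrite Cu2_pi_mul. Qed.

HB.instance Definition _ := Monoid_hasZero.Build Cu2 Cu2_mul0 Cu2_mulr0.

(* Main.v *)
Require Import Defs.
From mathcomp Require Import all_boot all_order all_algebra.
From mathcomp Require Import finmap complex.
From mathcomp Require Import all_classical all_reals all_analysis.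
From mathcomp.analysis Require Import showcase.summability.
From mathcomp Require Import ring lra.
Import Order.TTheory GRing.Theory Num.Theory.
Import numFieldNormedType.Exports.
Import Normc.
Local Open Scope classical_set_scope.
Local Open Scope ring_scope.

(** Evaluate everything at the identity [e] of the monoid. If [st = e] and
    [(s, t) <> (e, e)], then [s] is not idempotent, hence [mu s >= N] and
    [|(f # g)(e) - f(e) g(e)| <= ||f|| ||g|| / N]. So the four relations say that
    the scalars [a(e), b(e), c(e), d(e)] satisfy [ab = 1 = cd], [ad = 0 = cb] up to
    such errors, while [(ab)(cd) = (ad)(cb)] exactly. With [p = ||a|| ||b||] and
    [q = ||c|| ||d||] this gives [(N - p)(N - q) <= pq] as soon as [p, q <= N],
    hence [N <= p + q <= 1 + pq]. As also [1 <= pq], [pq] is at least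
    [max(1, N - 1)], which is more than the stated bound. The only fact needed
    about [Cu_2] is that [e] is not the zero element. *)

Local Notation "x %:C" := (real_complex _ x) (at level 1, format "x %:C").

#[local] Existing Instance totally_filter.

(** * Unconditional sums of real and complex families *)

Lemma partial_sumE (I : choiceType) (V : zmodType) (F : I -> V) (A : {fset I}) :
  partial_sum F A = \sum_(i <- A) F i.
Proof. by rewrite /partial_sum (big_seq_fsetE _ A xpredT). Qed.

Lemma ler_sum_fset (I : choiceType) (K : numDomainType) (F : I -> K)
    (A B : {fset I}) :
  (forall i, 0 <= F i) -> (A `<=` B)%fset ->
  \sum_(i <- A) F i <= \sum_(i <- B) F i.
Proof.
move=> F0 AB; rewrite [leRHS](bigID (mem A))/= -[leLHS]addr0.
apply: lerD; last by apply: sumr_ge0.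
suff -> : \sum_(i <- A) F i = \sum_(i <- B | i \in A) F i by [].
rewrite [RHS]big_mkcond -(big_fset_incl _ AB); first by apply: eq_big_seq => i ->.
by move=> i _ /negbTE ->.
Qed.

(** Monotone convergence: the limit is the supremum of the finite sums, since every finite set
    containing one that nearly attains it is at least as close. *)
Lemma cvg_partial_sum_ge0 {I : choiceType} {R : realType} {H : I -> R} {M : R} :
  (forall i, 0 <= H i) -> (forall A : {fset I}, \sum_(i <- A) H i <= M) ->
  exists l : R, partial_sum H @ totally --> l.
Proof.
move=> H0 HM; set E := range (partial_sum H).
have supE : has_sup E.
  split; first by exists (partial_sum H fset0), fset0.
  by exists M => _ [A _ <-]; rewrite partial_sumE.
exists (sup E); apply/cvgrPdist_le => e e0.
have [_ [A _ <-] ltA] := sup_adherent e0 supE.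
exists A => //= B AB.
have leB : partial_sum H B <= sup E by apply: (ub_le_sup (proj2 supE)); exists B.
have := ler_sum_fset _ _ _ _ _ H0 AB; rewrite -!partial_sumE => leAB.
by rewrite ger0_norm; lra.
Qed.

Lemma normcR (R : rcfType) (z : R[i]) : `|z| = (normc z)%:C.
Proof. by []. Qed.

Lemma normc_Re_Im (R : rcfType) (z : R[i]) :
  `|complex.Re z| <= normc z /\ `|complex.Im z| <= normc z.
Proof.
case: z => x y /=; rewrite -!sqrtr_sqr.
by split; apply: ler_wsqrtr; rewrite ?lerDl ?lerDr sqr_ge0.
Qed.

Lemma cvg_real_complex (I : choiceType) (R : realType) (u : {fset I} -> R) (l : R) :
  u @ totally --> l ->
  (fun A => (u A)%:C : R[i]^o) @ totally --> (l%:C : R[i]^o).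
Proof.
move=> /cvgrPdist_le ul; apply/cvgrPdist_le => -[e e'] /=.
(* A positive element of [R[i]] has imaginary part zero, so the tolerance is real. *)
rewrite ltcE /= => /andP[/eqP -> e0].
near=> A; rewrite -rmorphB normcR lecR /= expr0n /= addr0 sqrtr_sqr.
by near: A; exact: ul.
Unshelve. all: by end_near. Qed.

Lemma cvg_partial_sum {I : choiceType} {R : realType} {F : I -> R[i]^o} {M : R} :
  (forall A : {fset I}, \sum_(i <- A) normc (F i) <= M) ->
  exists l : R[i]^o, partial_sum F @ totally --> l.
Proof.
move=> FM.
(* Re F and Im F are differences of nonnegative families with bounded sums:
   g = (|F| + g) - |F|. *)
have FM2 (g : I -> R) : (forall i, `|g i| <= normc (F i)) ->
    (forall i, 0 <= normc (F i) + g i) /\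
    (forall A : {fset I}, \sum_(i <- A) (normc (F i) + g i) <= M + M).
  move=> gF; split=> [i|A]; first by move: (gF i); rewrite ler_norml => /andP[]; lra.
  rewrite big_split /=; apply: lerD => //; apply: le_trans (FM A).
  by apply: ler_sum => i _; rewrite (le_trans (ler_norm _)).
have [R0 RM] := FM2 _ (fun i => proj1 (normc_Re_Im _ (F i))).
have [I0 IM] := FM2 _ (fun i => proj2 (normc_Re_Im _ (F i))).
have N0 i : 0 <= normc (F i) by apply: le_trans (proj1 (normc_Re_Im _ (F i))).
have [l1 /cvg_real_complex c1] := cvg_partial_sum_ge0 N0 FM.
have [l2 /cvg_real_complex c2] := cvg_partial_sum_ge0 R0 RM.
have [l3 /cvg_real_complex c3] := cvg_partial_sum_ge0 I0 IM.
exists ((l2%:C - l1%:C) + 'i%C * (l3%:C - l1%:C)).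
rewrite (_ : partial_sum F = fun A =>
    ((partial_sum (fun i => normc (F i) + complex.Re (F i)) A)%:C
      - (partial_sum (fun i => normc (F i)) A)%:C)
    + 'i%C * ((partial_sum (fun i => normc (F i) + complex.Im (F i)) A)%:C
      - (partial_sum (fun i => normc (F i)) A)%:C)).
  exact: cvgD (cvgB c2 c1) (cvgZl_tmp (k := 'i%C : R[i]) (cvgB c3 c1)).
apply/funext => A.
rewrite !partial_sumE !big_split /= -!rmorphB /=.
have addKl (x y : R) : x + y - x = y by rewrite addrAC subrr add0r.
rewrite !addKl !rmorph_sum mulr_sumr -big_split; apply: eq_bigr => i _ /=.
exact/complexE.
Qed.

(** [summability.sum] is a limit operator, so convergence is obtained first; the bound then passes
    to the limit along finite sets containing [p]. *)
Lemma normc_sum_sub {I : choiceType} {R : realType} {F : I -> R[i]^o} {M : R}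
    (p : I) :
  (forall A : {fset I}, \sum_(i <- A | i != p) normc (F i) <= M) ->
  normc (summability.sum F - F p) <= M.
Proof.
move=> FM.
have [l Fl] : exists l : R[i]^o, partial_sum F @ totally --> l.
  apply: (@cvg_partial_sum _ _ _ (normc (F p) + M)) => A.
  apply: (le_trans (ler_sum_fset _ _ _ _ (p |` A)%fset _ _)) => [i||].
  - by apply: le_trans (proj1 (normc_Re_Im _ (F i))).
  - exact: fsubsetUr.
  by rewrite (bigD1_seq p) ?fset1U1 ?fset_uniq//= lerD2l.
have hF := @norm_hausdorff _ R[i]^o.
rewrite /summability.sum (cvg_lim hF Fl).
apply/ler_addgt0Pr => e e0.
have [A [/= lA pA]] : exists A : {fset I},
    `|l - partial_sum F A| <= e%:C /\ p \in A.
  move/cvgrPdist_le: Fl => /(_ e%:C); rewrite ltcR => /(_ e0) [B _ Bl].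
  exists (p |` B)%fset; split; last exact: fset1U1.
  by apply: Bl; exact: fsubsetUr.
move: lA; rewrite normcR lecR partial_sumE (bigD1_seq p) ?fset_uniq//= => lA.
set z := \sum_(i <- A | i != p) F i in lA.
have zM : normc z <= M.
  rewrite -lecR -normcR (le_trans (ler_norm_sum _ _ _))//.
  by rewrite -rmorph_sum lecR.
have -> : l - F p = (l - (F p + z)) + z by rewrite opprD addrA subrK.
by rewrite addrC; apply: le_trans (le_normcD _ _) _; rewrite lerD.
Qed.

(** * Weighted norms and the product evaluated at the identity *)

(** A finite set of pairs lies in the product of its two projections, where the sum factors. *)
Lemma sum_mul_fset_le {T1 T2 : choiceType} {R : realType} {u : T1 -> R}
    {v : T2 -> R} {U V : R} :
  (forall x, 0 <= u x) -> (forall y, 0 <= v y) ->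
  (forall A : {fset T1}, \sum_(x <- A) u x <= U) ->
  (forall B : {fset T2}, \sum_(y <- B) v y <= V) ->
  forall C : {fset (T1 * T2)}, \sum_(p <- C) u p.1 * v p.2 <= U * V.
Proof.
move=> u0 v0 uU vV C.
pose A := [fset p.1 | p in C]%fset; pose B := [fset p.2 | p in C]%fset.
have CAB : (C `<=` A `*` B)%fset.
  by apply/fsubsetP => p pC; rewrite in_fsetM !in_imfset.
apply: (le_trans (ler_sum_fset _ _ _ _ _ _ CAB)) => [p|]; first exact: mulr_ge0.
have -> : \sum_(p <- (A `*` B)%fset) u p.1 * v p.2 =
    \sum_(p <- [seq (x, y) | x <- A, y <- B]) u p.1 * v p.2.
  apply: perm_big; apply: uniq_perm.
  - exact: fset_uniq.
  - by apply: allpairs_uniq; rewrite ?fset_uniq// => -[? ?] [? ?].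
  move=> [x y]; rewrite in_fsetM /=; apply/andP/allpairsP => [[xA yB]|].
    by exists (x, y).
  by move=> [[x' y'] [/= xA yB [-> ->]]].
rewrite big_allpairs /=; under eq_bigr => x _ do rewrite -mulr_sumr.
by rewrite -mulr_suml; apply: ler_pM => //; apply: sumr_ge0.
Qed.

Lemma normc_ge0 (R : rcfType) (z : R[i]) : 0 <= normc z.
Proof. exact: le_trans (proj1 (normc_Re_Im _ z)). Qed.

Lemma sum_le_l1_norm {R : realType} {S : monoid0Type} {mu : nonzero S -> R}
    {f : nonzero S -> R[i]} :
  (forall s, 0 <= mu s) -> l1 mu f ->
  forall A : {fset nonzero S}, \sum_(s <- A) normc (f s) * mu s <= l1_norm mu f.
Proof.
move=> mu0 lf A; rewrite -lee_fin /l1_norm fineK; last first.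
  rewrite ge0_fin_numE//; apply: esum_ge0 => s _.
  by rewrite lee_fin mulr_ge0// normc_ge0.
apply: esum_ge; exists [set` A]; first by split=> //; exact: finite_fset.
by rewrite fsbig_finite ?finite_fset//= set_fsetK sumEFin.
Qed.

(** If s = ss, then s = s(st) = (ss)t = st = 1, and hence t = 1. *)
Lemma mul_eq1_nonidempotent {S : monoid0Type} {s t : S} :
  (s * t)%g = 1%g -> (s != 1%g) || (t != 1%g) -> s <> (s * s)%g.
Proof.
move=> st1 + ss.
have s1 : s = 1%g by rewrite -[s]mulg1 -st1 mulgA -ss.
by move: st1; rewrite s1 mul1g => ->; rewrite eqxx.
Qed.

(** The first bound gains the factor [N] from the pairs other than (e, e). The second keeps the pair
    (e, e) as well; it serves to show that ‖a‖‖b‖ and ‖c‖‖d‖ are at least 1. *)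
Lemma l1_mul_at1 {R : realType} {S : monoid0Type} {mu : nonzero S -> R} {N : R}
    {e : nonzero S} {f g : nonzero S -> R[i]} :
  val e = 1%g -> 0 < N -> (forall s, 1 <= mu s) ->
  (forall s, ~ idempotents (val s) -> N <= mu s) -> l1 mu f -> l1 mu g ->
  N * normc (l1_mul f g e - f e * g e) <= l1_norm mu f * l1_norm mu g /\
  normc (l1_mul f g e - f e * g e) + normc (f e * g e)
    <= l1_norm mu f * l1_norm mu g.
Proof.
move=> e1 N0 mu1 muN lf lg.
have mu0 s : 0 <= mu s by rewrite (le_trans ler01).
set F := fun p : nonzero S * nonzero S =>
  if (val p.1 * val p.2)%g == val e then f p.1 * g p.2 else 0 : R[i]^o.
pose w p := (normc (f p.1) * mu p.1) * (normc (g p.2) * mu p.2).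
have u0 h s : 0 <= normc (h s) * mu s :> R by rewrite mulr_ge0// normc_ge0.
have w0 p : 0 <= w p by apply: mulr_ge0.
have wle (A : {fset nonzero S * nonzero S}) :
    \sum_(p <- A) w p <= l1_norm mu f * l1_norm mu g.
  apply: (sum_mul_fset_le (u0 f) (u0 g)) => A'; exact: sum_le_l1_norm.
(* Applied with c = 1 to every pair, and with c = N to the pairs other than (e, e). *)
have normF p c : (F p != 0 -> c <= mu p.1 * mu p.2) -> c * normc (F p) <= w p.
  rewrite /F; case: ifP => [_|_ _]; last by rewrite normc0 mulr0.
  have [->|fg0 /(_ isT) cmu] := eqVneq (f p.1 * g p.2) 0.
    by rewrite normc0 mulr0.
  rewrite /w mulrACA mulrC normcM; apply: ler_wpM2l => //.
  by apply: mulr_ge0; exact: normc_ge0.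
have Fe : F (e, e) = f e * g e by rewrite /F /= e1 mulg1 eqxx.
have leF p : normc (F p) <= w p.
  by rewrite -[leLHS]mul1r; apply: normF => _; rewrite mulr_ege1.
split.
  rewrite -ler_pdivlMl// -Fe; apply: normc_sum_sub => A.
  rewrite ler_pdivlMl// mulr_sumr; apply: le_trans (wle A).
  rewrite [leRHS](bigID (fun p => p != (e, e)))/= -[leLHS]addr0.
  apply: lerD; last by apply: sumr_ge0.
  apply: ler_sum => -[s t] ne; apply: normF => /=; rewrite /F/=.
  case: ifP => [/eqP st _|_]; last by rewrite eqxx.
  rewrite -[N]mulr1; apply: ler_pM (ltW N0) ler01 _ (mu1 _); apply: muN => -[ss _].
  apply: (mul_eq1_nonidempotent (etrans st e1)) ss.
  by move: ne; rewrite xpair_eqE negb_and -e1 !val_eqE.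
rewrite -lerBrDr -Fe; apply: normc_sum_sub => A.
(* Adjoining (e, e) makes room for the term f(e) g(e), which is bounded by [w (e, e)]. *)
rewrite lerBrDr; apply: le_trans (wle ((e, e) |` A)%fset).
rewrite [leRHS](bigD1_seq (e, e)) ?fset1U1 ?fset_uniq//= addrC; apply: lerD => //.
apply: (@le_trans _ _ (\sum_(p <- A | p != (e, e)) w p)).
  apply: ler_sum => p _; exact: leF.
rewrite big_mkcond [leRHS]big_mkcond /=.
apply: ler_sum_fset; last exact: fsubsetUr.
by move=> p; case: ifP.
Qed.

(** * The identity of [Cu2] is not its zero element *)

(* The usual action of Cu_2 on words by partial maps; it separates the identity
   from the zero element, which acts as the nowhere defined map. *)
Definition letter_act (l : Cu2_letter) (x : seq 'I_2) : option (seq 'I_2) :=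
  match l with
  | inl i => if x is j :: y then if i == j then Some y else None else None
  | inr i => Some (i :: x)
  end.

Definition word_act (w : Cu2_word) (x : seq 'I_2) : option (seq 'I_2) :=
  if w is Some u then foldr (fun l => obind (letter_act l)) (Some x) u else None.

Lemma word_act_mul v w x :
  word_act (Cu2_wmul v w) x = obind (word_act v) (word_act w x).
Proof.
case: v w => [v|] [w|] //=; last by case: foldr.
by rewrite foldr_cat; elim: v => [|l v IH] /=; [case: foldr|rewrite IH; case: foldr].
Qed.

(** The partial maps satisfy the defining relations: pushing j and then popping i is the identity if
    i = j and nowhere defined otherwise. *)
Lemma word_act_congr v w : Cu2_congr v w -> word_act v =1 word_act w.
Proof.
elim=> {v w} //.
- by move=> x y _ IH u; rewrite IH.
- by move=> x y z _ IH1 _ IH2 u; rewrite IH1.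
- move=> x x' y y' _ IH1 _ IH2 u; rewrite !word_act_mul IH2.
  by case: (word_act y' u) => //= v; apply: IH1.
- by move=> i j u /=; case: eqP.
Qed.

Lemma Cu2_1_neq_lozenge : (1%g : Cu2) != lozenge.
Proof. by apply/eqP => /Cu2_piP /word_act_congr /(_ [::]). Qed.

(** * The lower bound for the constant *)

Lemma C_PI_l1_ge (R : realType) (S : monoid0Type) (mu : nonzero S -> R) (N : R) :
  (1%g : S) != lozenge -> 0 < N -> (forall s, 1 <= mu s) ->
  (forall s, ~ idempotents (val s) -> N <= mu s) ->
  ((Num.max 1 (N - 1))%:E <= C_PI_l1 mu)%E.
Proof.
move=> S1 N0 mu1 muN; apply: le_ereal_inf_tmp => r [a [b [c [d]]]].
move=> [[la lb lc ld] [ab cd] [ad cb] {r}->]; rewrite lee_fin.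
pose e : nonzero S := exist _ 1%g S1.
have at1 := @l1_mul_at1 R S mu N e _ _ erefl N0 mu1 muN.
have [abN ab1] := at1 _ _ la lb; have [cdN cd1] := at1 _ _ lc ld.
have [adN _] := at1 _ _ la ld; have [cbN _] := at1 _ _ lc lb.
have d1 : delta R 1%g e = 1 by rewrite /delta eqxx.
rewrite ab cd d1 in abN ab1 cdN cd1; rewrite ad cb !sub0r !normcN in adN cbN.
have triangle (z : R[i]) : 1 <= normc (1 - z) + normc z.
  by rewrite -{1}(@normc1 R) -{1}(subrK z 1); exact: le_normcD.
have tab := triangle (a e * b e); have tcd := triangle (c e * d e).
have regroup : normc (a e * b e) * normc (c e * d e) =
    normc (a e * d e) * normc (c e * b e).
  by rewrite -!normcM; congr normc; ring.
rewrite (_ : l1_norm mu a * _ * _ * _ =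
  (l1_norm mu a * l1_norm mu b) * (l1_norm mu c * l1_norm mu d)); last by ring.
have pq : (l1_norm mu a * l1_norm mu b) * (l1_norm mu c * l1_norm mu d) =
  (l1_norm mu a * l1_norm mu d) * (l1_norm mu c * l1_norm mu b) by ring.
have prod_le : (N * normc (a e * b e)) * (N * normc (c e * d e)) <=
    (l1_norm mu a * l1_norm mu b) * (l1_norm mu c * l1_norm mu d).
  by rewrite mulrACA regroup -mulrACA pq; apply: ler_pM => //;
    rewrite mulr_ge0 ?normc_ge0 ?ltW.
(* What remains is real arithmetic, with p = ‖a‖‖b‖, q = ‖c‖‖d‖, x = |a(e)b(e)|, y = |c(e)d(e)|, u =
   |1 - a(e)b(e)| and v = |1 - c(e)d(e)|. *)
move: prod_le ab1 cd1 abN cdN tab tcd {regroup pq adN cbN}.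
move: (normc_ge0 _ (a e * b e)) (normc_ge0 _ (c e * d e)).
move: (normc (1 - a e * b e)) (normc (1 - c e * d e)).
move: (normc (a e * b e)) (normc (c e * d e)).
move: (l1_norm mu a * _) (l1_norm mu c * _) => p q x y u v x0 y0.
move=> prod_le ux vy uN vN tx ty.
have p1 : 1 <= p by lra.
have q1 : 1 <= q by lra.
rewrite ge_max; apply/andP; split; first by nra.
(* From (p - 1)(q - 1) >= 0 one gets p + q <= 1 + pq. *)
suff : N <= p + q by nra.
(* If p + q < N, both N - p and N - q are positive, so the lower bounds on Nx and Ny multiply;
   expanding (N - p)(N - q) <= pq gives N <= p + q, a contradiction. *)
rewrite leNgt; apply/negP => pqN.
have xN : N - p <= N * x by nra.
have yN : N - q <= N * y by nra.
have : (N - p) * (N - q) <= p * q.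
  by apply: le_trans prod_le; apply: ler_pM => //; lra.
nra.
Qed.

Theorem proposition4p13 (R : realType) (N : R) (hN : 0 < N)
    (mu : nonzero Cu2 -> R) (hmu : quasi_weight mu)
    (mu_ge1 : forall s : nonzero Cu2, 1 <= mu s)
    (mu_geN : forall s : nonzero Cu2, ~ idempotents (val s) -> N <= mu s) :
  (((N / 86) `^ 3^-1)%:E <= C_PI_l1 mu)%E.
Proof.
apply: le_trans (C_PI_l1_ge R Cu2 mu N Cu2_1_neq_lozenge hN mu_ge1 mu_geN).
rewrite lee_fin; set K := Num.max _ _.
have K1 : 1 <= K by rewrite le_max lexx.
have KN : N - 1 <= K by rewrite le_max lexx orbT.
(* By monotonicity of the cube root it suffices that N / 86 <= K^3, and N <= K + 1 <= 2K <= 86 K^3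
   because K >= 1. *)
have -> : K = (K ^+ 3) `^ 3^-1.
  by rewrite -powR_mulrn ?(le_trans ler01)// -powRrM divff// powRr1 ?(le_trans ler01).
have KK : K <= K ^+ 3 by rewrite -{1}[K]expr1 ler_weXn2l.
apply: ge0_ler_powR; rewrite ?nnegrE ?invr_ge0 ?ler0n//.
- by rewrite divr_ge0// ltW.
- by rewrite exprn_ge0 // (le_trans ler01).
- by rewrite ler_pdivrMr//; lra.
Qed.
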